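(* Let $S$ be a restriction semigroup. (1) The functors $\widetilde{U}\colon\widetilde{\mathcal{A}}(S)\to\mathcal{P}(S)$ and $\widetilde{G}\colon\mathcal{P}(S)\to\widetilde{\mathcal{A}}(S)$ establish an equivalence between the categories $\widetilde{\mathcal{A}}(S)$ and $\mathcal{P}(S)$. (2) The functor $U\colon\mathcal{A}(S)\to\mathcal{P}(S)$ is a left adjoint to the functor $\widehat{I}\widehat{G}\colon\mathcal{P}(S)\to\mathcal{A}(S)$. (3) The functor $U\colon\mathcal{A}(S)\to\mathcal{P}(S)$ is a right adjoint to the functor $\widetilde{I}\widetilde{G}\colon\mathcal{P}(S)\to\mathcal{A}(S)$.
   Context: A restriction semigroup is an algebra $(S;\cdot,{}^*,{}^+)$ of type $(2,1,1)$ such that $(S;\cdot)$ is a semigroup and the following identities hold: $x^+x=x$, $x^+y^+=y^+x^+$, $(x^+y)^+=x^+y^+$, $(xy)^+x=xy^+$; $xx^*=x$, $x^*y^*=y^*x^*$, $(xy^* )^*=x^*y^*$, $y(xy)^*=x^*y$; $(x^+)^*=x^+$, $(x^* )^+=x^*$. Morphisms preserve all three operations. $P(S)=\{s^*\colon s\in S\}=\{s^+\colon s\in S\}$ is the semilattice of projections. The natural partial order is: $s\le t$ iff $s=et$ for some $e\in P(S)$. Elements $s,t$ are compatible, $s\sim t$, if $st^*=ts^*$ and $t^+s=s^+t$. A morphism $\psi\colon T\to S$ is proper if it is surjective and $\psi(u)=\psi(v)$ implies $u\sim v$ for all $u,v\in T$. Inverse semigroups are restriction semigroups via $s^*=s^{-1}s$,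 $s^+=ss^{-1}$. $\mathcal{I}(X)$ is the symmetric inverse semigroup of all partial bijections of $X$, composed from right to left. For a subset $B$ of a poset, $B^\downarrow$ is the set of elements lying below some element of $B$, and $b^\downarrow=\{b\}^\downarrow$. A premorphism $\varphi\colon S\to T$ between restriction semigroups is a map with $\varphi(s)\varphi(t)\le\varphi(st)$, $\varphi(s)^*\le\varphi(s^* )$ and $\varphi(s)^+\le\varphi(s^+)$ for all $s,t\in S$. For $T=\mathcal{I}(X)$ we write $\varphi_s$ for $\varphi(s)$. The category $\mathcal{A}(S)$: objects are triples $(\alpha,p,X)$ where $X$ is a semilattice, $p\colon X\to P(S)$ is a semilattice morphism and $\alpha\colon S\to\mathcal{I}(X)$ is a premorphism such that: (A1) for all $s\in S$, $\operatorname{dom}\alpha_s$ and $\operatorname{ran}\alpha_s$ are order ideals of $X$; (A2) for all $s\in S$, $\alpha_s$ is an order isomorphism (from its domain onto its range); (A3) for all $e\in P(S)$, $(p^{-1}(e))^\downarrow\subseteq\operatorname{dom}\alpha_e\subseteq p^{-1}(e^\downarrow)$; (A4) for all $s\in S$, $\operatorname{dom}\alpha_s\cap p^{-1}(s^* )\ne\varnothing$. A morphism from $(\alpha,p_\alpha,X)$ to $(\beta,p_\beta,Y)$ is a semilattice morphism $f\colon X\to Y$ such that (M1) $p_\alpha=p_\beta f$; (M2) $f(\operatorname{dom}\alpha_s)\subseteq\operatorname{dom}\beta_s$ and $\beta_s(f(e))=f(\alpha_s(e))$ for all $s\in S$ and $e\in\operatorname{dom}\alpha_s$. $\widehat{\mathcal{A}}(S)$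 is the full subcategory of $\mathcal{A}(S)$ whose objects satisfy (A3a): for all $s\in S$, $\operatorname{dom}\alpha_s=\{y\in X\colon y\in\operatorname{dom}\alpha_t\cap p^{-1}(t^* )\text{ for some }t\le s\}$. $\widetilde{\mathcal{A}}(S)$ is the full subcategory whose objects satisfy (A3b): for all $s\in S$, $\operatorname{dom}\alpha_s=(\operatorname{dom}\alpha_s\cap p^{-1}(s^* ))^\downarrow$. $\widehat I$ and $\widetilde I$ are the inclusion functors of $\widehat{\mathcal{A}}(S)$ and $\widetilde{\mathcal{A}}(S)$ into $\mathcal{A}(S)$. The functor $\widetilde F\colon\mathcal{A}(S)\to\widetilde{\mathcal{A}}(S)$ sends $(\varphi,p,X)$ to $(\widetilde\varphi,p,X)$, where $\widetilde\varphi_s$ is the restriction of $\varphi_s$ to $\{x\in\operatorname{dom}\varphi_s\colon p(x)=s^*\}^\downarrow$, and leaves the underlying maps of morphisms unchanged. The category $\mathcal{P}(S)$: objects are proper morphisms $\psi\colon T\to S$ with $T$ a restriction semigroup; a morphism from $\psi_1\colon T_1\to S$ to $\psi_2\colon T_2\to S$ is a morphism of restriction semigroups $\gamma\colon T_1\to T_2$ with $\psi_2\gamma=\psi_1$. For an object $(\alpha,p,X)$ of $\mathcal{A}(S)$, the partial action product $X\rtimes^p_\alpha S$ is the restriction semigroup on the set $\{(x,s)\in X\times S\colon x\in\operatorname{ran}\alpha_s,\ p(x)=s^+\}$ with $(x,s)(y,t)=(\alpha_s(\alpha_s^{-1}(x)\wedge y),st)$, $(x,s)^*=(\alpha_s^{-1}(x),s^*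 )$, $(x,s)^+=(x,s^+)$. The functor $U\colon\mathcal{A}(S)\to\mathcal{P}(S)$ sends $(\alpha,p,X)$ to the proper morphism $X\rtimes^p_\alpha S\to S$, $(x,s)\mapsto s$, and a morphism $f\colon X\to Y$ to the map $(x,s)\mapsto(f(x),s)$. Put $\widetilde U=U\widetilde I$. The functor $\widehat G\colon\mathcal{P}(S)\to\widehat{\mathcal{A}}(S)$ sends $\psi\colon T\to S$ to $(\widehat\psi,\psi|_{P(T)},P(T))$, where $\widehat\psi\colon S\to\mathcal{I}(P(T))$ is given by $\operatorname{dom}\widehat\psi_s=\{e\in P(T)\colon e\le t^*\text{ for some }t\in T\text{ with }\psi(t)\le s\}$ and $\widehat\psi_s(e)=(te)^+$ for any $t\in T$ with $e\le t^*$, $\psi(t)\le s$ (this is well defined); and it sends $\gamma\colon T_1\to T_2$ to $\gamma|_{P(T_1)}\colon P(T_1)\to P(T_2)$. Put $\widetilde G=\widetilde F\widehat I\widehat G\colon\mathcal{P}(S)\to\widetilde{\mathcal{A}}(S)$. *)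

(* Defs.v *)
From HB Require Import structures.
From mathcomp Require Import all_boot all_order.
From mathcomp Require Import boolp classical_sets.

Set Implicit Arguments.
Unset Strict Implicit.
Unset Printing Implicit Defensive.

Import Order.TTheory.

Local Open Scope group_scope.
Local Open Scope classical_set_scope.

Record category := Category {
  obj :> Type;
  hom : obj -> obj -> Type;
  idm : forall a, hom a a;
  compm : forall a b c, hom b c -> hom a b -> hom a c;
  compm1l : forall a b (f : hom a b), compm (idm b) f = f;
  compm1r : forall a b (f : hom a b), compm f (idm a) = f;
  compmA : forall a b c d (h : hom c d) (g : hom b c) (f : hom a b),
    compm h (compm g f) = compm (compm h g) f }.

Arguments hom {_} _ _.
Arguments idm {_} _.
Arguments compm {_ _ _ _} _ _.

Record functor (C D : category) := Functor {
  fobj :> C -> D;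
  fmap : forall a b : C, hom a b -> hom (fobj a) (fobj b);
  fmap_id : forall a : C, fmap (idm a) = idm (fobj a);
  fmap_comp : forall (a b c : C) (g : hom b c) (f : hom a b),
    fmap (compm g f) = compm (fmap g) (fmap f) }.

Arguments fmap {_ _} _ {_ _} _.

Definition idF (C : category) : functor C C :=
  @Functor C C id (fun _ _ f => f) (fun _ => erefl) (fun _ _ _ _ _ => erefl).

Section CompF.
Variables (C D E : category) (G : functor D E) (F : functor C D).

Lemma compF_id (a : C) : fmap G (fmap F (idm a)) = idm (G (F a)).
Proof. by rewrite !fmap_id. Qed.

Lemma compF_comp (a b c : C) (g : hom b c) (f : hom a b) :
  fmap G (fmap F (compm g f)) = compm (fmap G (fmap F g)) (fmap G (fmap F f)).
Proof. by rewrite !fmap_comp. Qed.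

Definition compF : functor C E :=
  @Functor C E (fun a => G (F a)) (fun _ _ f => fmap G (fmap F f))
    compF_id compF_comp.

End CompF.

Definition is_iso (C : category) (a b : C) (f : hom a b) : Prop :=
  exists g : hom b a, compm g f = idm a /\ compm f g = idm b.

Definition nat_iso (C D : category) (F G : functor C D) : Prop :=
  exists eta : forall a : C, hom (F a) (G a),
    (forall (a b : C) (f : hom a b),
       compm (eta b) (fmap F f) = compm (fmap G f) (eta a)) /\
    (forall a : C, is_iso (eta a)).

Definition establish_equivalence (C D : category)
    (F : functor C D) (G : functor D C) : Prop :=
  nat_iso (compF G F) (idF C) /\ nat_iso (compF F G) (idF D).

Definition left_adjoint (C D : category)
    (L : functor C D) (R : functor D C) : Prop :=
  exists phi : forall (c : C) (d : D), hom (L c) d -> hom c (R d),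
    (forall (c : C) (d : D), bijective (phi c d)) /\
    (forall (c c' : C) (d d' : D) (h : hom c' c) (k : hom d d')
            (f : hom (L c) d),
       phi c' d' (compm k (compm f (fmap L h))) =
       compm (fmap R k) (compm (phi c d f) h)).

Section FullSubcategory.
Variables (C : category) (P : C -> Prop).

Definition full_subcategory : category :=
  @Category {a : C | P a} (fun a b => hom (sval a) (sval b))
    (fun a => idm (sval a)) (fun _ _ _ g f => compm g f)
    (fun _ _ f => compm1l f) (fun _ _ f => compm1r f)
    (fun _ _ _ _ h g f => compmA h g f).

Definition inclF : functor full_subcategory C :=
  @Functor full_subcategory C (fun a => sval a) (fun _ _ f => f)
    (fun _ => erefl) (fun _ _ _ _ _ => erefl).

End FullSubcategory.

(** [rstar] and [rplus] are the unary operations x^* and x^+.  The choice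
    structure carried by MathComp semigroups and semilattices is no
    restriction in the presence of the classical axioms of [boolp], and
    morphisms ignore it. *)
HB.mixin Record Semigroup_isRestriction S of Semigroup S := {
  rstar : S -> S;
  rplus : S -> S;
  rplus_mul : forall x : S, rplus x * x = x;
  rplusC : forall x y : S, rplus x * rplus y = rplus y * rplus x;
  rplus_mull : forall x y : S, rplus (rplus x * y) = rplus x * rplus y;
  rplus_ample : forall x y : S, rplus (x * y) * x = x * rplus y;
  mul_rstar : forall x : S, x * rstar x = x;
  rstarC : forall x y : S, rstar x * rstar y = rstar y * rstar x;
  rstar_mulr : forall x y : S, rstar (x * rstar y) = rstar x * rstar y;
  rstar_ample : forall x y : S, y * rstar (x * y) = rstar x * y;
  rstar_rplus : forall x : S, rstar (rplus x) = rplus x;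
  rplus_rstar : forall x : S, rplus (rstar x) = rstar x
}.

#[short(type="restrictionSemigroupType")]
HB.structure Definition RestrictionSemigroup :=
  {S of Semigroup_isRestriction S & Semigroup S}.

HB.mixin Record isRestrictionMorphism (T S : restrictionSemigroupType)
    (f : T -> S) := {
  rmorph_star : {morph f : x / rstar x};
  rmorph_plus : {morph f : x / rplus x}
}.

#[short(type="restrictionMorphism")]
HB.structure Definition RestrictionMorphism (T S : restrictionSemigroupType) :=
  {f of isRestrictionMorphism T S f & @isMultiplicative T S f}.

Section MorphismTheory.
Variables (T S : restrictionSemigroupType) (f : restrictionMorphism T S).

Lemma rmM : {morph f : x y / x * y}. Proof. exact: gmulfM. Qed.
Lemma rmstar : {morph f : x / rstar x}. Proof. exact: rmorph_star. Qed.
Lemma rmplus : {morph f : x / rplus x}. Proof. exact: rmorph_plus. Qed.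

End MorphismTheory.

Lemma restrictionMorphism_eq (T S : restrictionSemigroupType)
  (f g : restrictionMorphism T S) : f =1 g -> f = g.
Proof.
case: f g => [f [[f1 f2] [f3]]] [g [[g1 g2] [g3]]] /= /funext fg.
case: _ / fg g1 g2 g3 => g1 g2 g3.
by rewrite (Prop_irrelevance f1 g1) (Prop_irrelevance f2 g2)
  (Prop_irrelevance f3 g3).
Qed.

Section IdComp.
Variables (R T S : restrictionSemigroupType).

HB.instance Definition _ := isRestrictionMorphism.Build T T idfun
  (fun _ => erefl) (fun _ => erefl).

Variables (g : restrictionMorphism T S) (f : restrictionMorphism R T).

Lemma comp_rstar : {morph g \o f : x / rstar x}.
Proof. by move=> x /=; rewrite !rmstar. Qed.

Lemma comp_rplus : {morph g \o f : x / rplus x}.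
Proof. by move=> x /=; rewrite !rmplus. Qed.

HB.instance Definition _ :=
  isRestrictionMorphism.Build R S (g \o f) comp_rstar comp_rplus.

End IdComp.

Definition is_proj (S : restrictionSemigroupType) (e : S) : bool :=
  `[< exists s, e = rstar s >].

Record proj (S : restrictionSemigroupType) :=
  Proj { pval :> S; _ : is_proj pval }.

HB.instance Definition _ S := [isSub for @pval S].
HB.instance Definition _ S := [Choice of proj S by <:].

Definition natle (S : restrictionSemigroupType) (s t : S) : Prop :=
  exists e : proj S, s = pval e * t.

Definition compatible (S : restrictionSemigroupType) (s t : S) : Prop :=
  s * rstar t = t * rstar s /\ rplus t * s = rplus s * t.

Section Theory.
Variable S : restrictionSemigroupType.
Implicit Types (s t u x y : S) (e f : proj S).

Lemma rstarK x : rstar (rstar x) = rstar x.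
Proof. by rewrite -{1}(rplus_rstar x) rstar_rplus rplus_rstar. Qed.

Lemma rplusK x : rplus (rplus x) = rplus x.
Proof. by rewrite -{1}(rstar_rplus x) rplus_rstar rstar_rplus. Qed.

Lemma is_projP x : reflect (rstar x = x) (is_proj x).
Proof.
by apply: (iffP (asboolP _)) => [[s ->]|<-]; [rewrite rstarK | exists x].
Qed.

Lemma is_proj_rplusP x : reflect (exists s, x = rplus s) (is_proj x).
Proof.
apply: (iffP (is_projP x)) => [xE|[s ->]]; last by rewrite rstar_rplus.
by exists x; rewrite -xE rplus_rstar.
Qed.

Lemma rstar_proj e : rstar e = e. Proof. by case: e => x /= /is_projP. Qed.
Lemma rplus_proj e : rplus e = e.
Proof. by rewrite -{1}rstar_proj rplus_rstar rstar_proj. Qed.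

Lemma projC e f : pval e * pval f = pval f * pval e :> S.
Proof. by rewrite -(rstar_proj e) -(rstar_proj f) rstarC. Qed.

Lemma projxx e : pval e * pval e = e :> S.
Proof. by rewrite -{2}(rstar_proj e) mul_rstar. Qed.

Lemma is_proj_rstar s : is_proj (rstar s).
Proof. by apply/asboolP; exists s. Qed.

Lemma is_proj_rplus s : is_proj (rplus s).
Proof. by apply/is_proj_rplusP; exists s. Qed.

Lemma is_proj_mul e f : is_proj (pval e * pval f).
Proof. by apply/is_projP; rewrite -{1}(rstar_proj f) rstar_mulr !rstar_proj. Qed.

Definition starP s : proj S := Proj (is_proj_rstar s).
Definition plusP s : proj S := Proj (is_proj_rplus s).
Definition mulP e f : proj S := Proj (is_proj_mul e f).

Lemma proj_inj e f : pval e = pval f -> e = f. Proof. exact: val_inj. Qed.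

Lemma starP_proj e : starP e = e.
Proof. by apply/val_inj; rewrite /= rstar_proj. Qed.

Lemma plusP_proj e : plusP e = e.
Proof. by apply/val_inj; rewrite /= rplus_proj. Qed.

Lemma starP_rstar s : starP (rstar s) = starP s.
Proof. by apply/val_inj; rewrite /= rstarK. Qed.

Lemma plusP_rplus s : plusP (rplus s) = plusP s.
Proof. by apply/val_inj; rewrite /= rplusK. Qed.

Lemma starP_rplus s : starP (rplus s) = plusP s.
Proof. by apply/val_inj; rewrite /= rstar_rplus. Qed.

Lemma plusP_rstar s : plusP (rstar s) = starP s.
Proof. by apply/val_inj; rewrite /= rplus_rstar. Qed.

Lemma rplusM s t : rplus (s * t) = rplus (s * rplus t).
Proof.
rewrite -rplus_ample rplus_mull.
by rewrite -{1}[s]rplus_mul -[rplus s * s * t]mulgA rplus_mull rplusC.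
Qed.

Lemma rstarM s t : rstar (s * t) = rstar (rstar s * t).
Proof.
rewrite -rstar_ample rstar_mulr.
by rewrite -{1}[t]mul_rstar [s * (t * _)]mulgA rstar_mulr rstarC.
Qed.

Lemma rstar_mule s e : rstar (s * pval e) = rstar s * pval e.
Proof. by rewrite -{1}(rstar_proj e) rstar_mulr rstar_proj. Qed.

Lemma rplus_emul e s : rplus (pval e * s) = pval e * rplus s.
Proof. by rewrite -{1}(rplus_proj e) rplus_mull rplus_proj. Qed.

Lemma rplus_mule s e : rplus (s * pval e) * s = s * pval e.
Proof. by rewrite rplus_ample rplus_proj. Qed.

Lemma rstar_emul e s : s * rstar (pval e * s) = pval e * s.
Proof. by rewrite rstar_ample rstar_proj. Qed.

Lemma natleP s t : natle s t <-> s = rplus s * t.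
Proof.
split=> [[e ->]|->]; last by exists (plusP s).
by rewrite rplus_emul -mulgA rplus_mul.
Qed.

Lemma natlePr s t : natle s t <-> s = t * rstar s.
Proof.
split=> [[e ->]|->]; first by rewrite rstar_emul.
by exists (plusP (t * rstar s)); rewrite /= (rplus_mule t (starP s)).
Qed.

Lemma natle_emul e s : natle (pval e * s) s. Proof. by exists e. Qed.

Lemma natle_mule s e : natle (s * pval e) s.
Proof. by apply/natlePr; rewrite rstar_mule mulgA mul_rstar. Qed.

Lemma natle_refl s : natle s s.
Proof. by exists (plusP s); rewrite /= rplus_mul. Qed.

Lemma natle_trans t s u : natle s t -> natle t u -> natle s u.
Proof. by move=> [e ->] [f ->]; exists (mulP e f); rewrite mulgA. Qed.

Lemma natle_rstar s t : natle s t -> natle (rstar s) (rstar t).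
Proof.
move=> /natlePr ->; rewrite rstar_mulr rstarC.
exact: (natle_emul (starP s)).
Qed.

Lemma natle_rplus s t : natle s t -> natle (rplus s) (rplus t).
Proof. by move=> [e ->]; rewrite rplus_emul; exists e. Qed.

Lemma natle_mul s s' t t' :
  natle s s' -> natle t t' -> natle (s * t) (s' * t').
Proof.
move=> [e ->] /natlePr ->; rewrite -mulgA [s' * (t' * _)]mulgA.
exact: natle_trans (natle_emul e _) (natle_mule _ (starP t)).
Qed.

End Theory.

(** The order on projections is the restriction of the natural partial order,
    see [proj_leE]; all semilattices are taken with the same display. *)

Fact semilattice_display : Order.disp_t. Proof. exact: Order.Disp tt tt. Qed.

Notation semilatticeType := (meetSemilatticeType semilattice_display).

Section ProjSemilattice.
Variable S : restrictionSemigroupType.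
Implicit Types e f g : proj S.

Definition proj_le e f := mulP e f == e.

Lemma mulPC : commutative (@mulP S).
Proof. by move=> e f; apply/val_inj; rewrite /= projC. Qed.

Lemma mulPA : associative (@mulP S).
Proof. by move=> e f g; apply/val_inj; rewrite /= mulgA. Qed.

Lemma mulPxx : idempotent_op (@mulP S).
Proof. by move=> e; apply/val_inj; rewrite /= projxx. Qed.

Lemma proj_le_refl : reflexive proj_le.
Proof. by move=> e; rewrite /proj_le mulPxx. Qed.

Lemma proj_le_anti : antisymmetric proj_le.
Proof. by move=> e f /andP[/eqP ef /eqP fe]; rewrite -ef mulPC fe. Qed.

Lemma proj_le_trans : transitive proj_le.
Proof.
by move=> f e g /eqP ef /eqP fg; rewrite /proj_le -ef -mulPA fg.
Qed.

HB.instance Definition _ := Order.Le_isPOrder.Build semilattice_display (proj S)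
  proj_le_refl proj_le_anti proj_le_trans.

HB.instance Definition _ := Order.POrder_Meet_isSemilattice.Build
  semilattice_display (proj S) mulPC mulPA (fun e f => erefl).

Lemma proj_leP e f : reflect (pval e * pval f = e :> S) (e <= f)%O.
Proof.
by apply: (iffP eqP) => [/(congr1 val)|ef] //; exact/val_inj.
Qed.

Lemma proj_leE e f : (e <= f)%O <-> natle (e : S) f.
Proof.
split=> [/proj_leP <-|[g ge]]; first exact: natle_emul.
by apply/proj_leP; rewrite ge -mulgA projxx.
Qed.

Lemma proj_meetE e f : (e `&` f)%O = pval e * pval f :> S. Proof. by []. Qed.

End ProjSemilattice.

Definition pinjective (X : choiceType) (f : X -> option X) : bool :=
  `[< forall x y z, f x = Some z -> f y = Some z -> x = y >].

(** The symmetric inverse semigroup on [X]; its product [pcomp] composes from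
    right to left. *)
Record pbij (X : choiceType) :=
  PBij { pfun :> X -> option X; _ : pinjective pfun }.

HB.instance Definition _ X := [isSub for @pfun X].
HB.instance Definition _ X := [Choice of pbij X by <:].

Section SymmetricInverse.
Variable X : choiceType.
Implicit Types (f g h : pbij X) (x y z : X).

Definition pdom f : set X := [set x | exists y, f x = Some y].
Definition pran f : set X := [set y | exists x, f x = Some y].

Lemma pbij_inj f x y z : f x = Some z -> f y = Some z -> x = y.
Proof. by case: f => f /= /asboolP; apply. Qed.

Lemma pbijP f g : (forall x y, f x = Some y <-> g x = Some y) -> f = g.
Proof.
move=> fg; apply/val_inj/funext => x /=.
case fx: (f x) => [y|]; first by symmetry; apply/fg.
by case gx: (g x) => [y|] //; move/fg: gx; rewrite fx.
Qed.

Fact pcomp_subproof f g : pinjective (fun x => obind f (g x)).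
Proof.
apply/asboolP => x y z.
case gx: (g x) => [x'|] //= fx; case gy: (g y) => [y'|] //= fy.
by move: gy; rewrite -(pbij_inj fx fy); apply: pbij_inj.
Qed.

Definition pcomp f g : pbij X := PBij (pcomp_subproof f g).

Definition pinv_fun f y : option X :=
  if pselect (exists x, f x = Some y) is left h then Some (sval (cid h))
  else None.

Lemma pinv_funP f x y : pinv_fun f y = Some x <-> f x = Some y.
Proof.
rewrite /pinv_fun; case: pselect => [h|nh]; last first.
  by split=> // fx; case: nh; exists x.
case: (cid h) => x' /= fx'; split=> [[<-] //|fx].
by rewrite (pbij_inj fx fx').
Qed.

Fact pinv_subproof f : pinjective (pinv_fun f).
Proof.
by apply/asboolP => x y z /pinv_funP fz /pinv_funP; rewrite fz => -[].
Qed.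

Definition pinv f : pbij X := PBij (pinv_subproof f).

Lemma pinvP f x y : pinv f y = Some x <-> f x = Some y.
Proof. exact: pinv_funP. Qed.

Fact prestr_subproof f (A : set X) :
  pinjective (fun x => if `[< A x >] then f x else None).
Proof.
by apply/asboolP => x y z; case: ifP => // _; case: ifP => // _; apply: pbij_inj.
Qed.

Definition prestr f (A : set X) : pbij X := PBij (prestr_subproof f A).

Lemma prestrP f A x y : prestr f A x = Some y <-> A x /\ f x = Some y.
Proof. by rewrite /=; case: asboolP => Ax; split=> // -[]. Qed.

(** Evaluation of a partial bijection at a point of its domain; the value
    outside the domain is junk. *)
Definition pev f x : X := odflt x (f x).

Lemma pevE f x y : f x = Some y -> pev f x = y.
Proof. by rewrite /pev => ->. Qed.

Definition pstar f := pcomp (pinv f) f.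
Definition pplus f := pcomp f (pinv f).

Lemma pcompP f g x z :
  pcomp f g x = Some z <-> exists2 y, g x = Some y & f y = Some z.
Proof.
rewrite /=; case: (g x) => [y|] /=; last by split=> [|[]].
by split=> [fy|[_ [<-]]] //; exists y.
Qed.

Lemma pstarP f x y : pstar f x = Some y <-> x = y /\ pdom f x.
Proof.
rewrite pcompP; split=> [[z fx /pinvP fy]|[<- [z fx]]].
  by split; [exact: pbij_inj fx fy | exists z].
by exists z => //; apply/pinvP.
Qed.

Lemma pplusP f x y : pplus f x = Some y <-> x = y /\ pran f x.
Proof.
rewrite pcompP; split=> [[z /pinvP fz]|[<- [z fz]]].
  by rewrite fz => -[<-]; split=> //; exists z.
by exists z => //; apply/pinvP.
Qed.

Lemma pcompA : associative pcomp.
Proof.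
by move=> f g h; apply/val_inj/funext => x /=; case: (h x).
Qed.

HB.instance Definition _ := isSemigroup.Build (pbij X) pcompA.

Lemma pplus_mul f : pplus f * f = f.
Proof.
apply: pbijP => x y; rewrite pcompP; split=> [[z fx /pplusP[<-]]|fx] //.
by exists y => //; apply/pplusP; split=> //; exists x.
Qed.

Lemma pplusC f g : pplus f * pplus g = pplus g * pplus f.
Proof.
by apply: pbijP => x y; rewrite !pcompP; split=> -[z /pplusP[<- ?] /pplusP[<- ?]];
  exists x; apply/pplusP.
Qed.

Lemma pplus_mull f g : pplus (pplus f * g) = pplus f * pplus g.
Proof.
apply: pbijP => x y; rewrite pplusP pcompP; split.
  move=> [<-] [z /pcompP[x' gz /pplusP[<- fx]]].
  by exists x'; apply/pplusP; split=> //; exists z.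
move=> [z /pplusP[<- [x' gx]] /pplusP[<- fx]]; split=> //.
by exists x'; apply/pcompP; exists x => //; apply/pplusP.
Qed.

Lemma pplus_ample f g : pplus (f * g) * f = f * pplus g.
Proof.
apply: pbijP => x y; rewrite !pcompP; split.
  move=> [z fx /pplusP[<- [w /pcompP[v gw fv]]]]; exists x => //.
  by apply/pplusP; split=> //; exists w; rewrite (pbij_inj fx fv).
move=> [z /pplusP[<- [w gw]] fx]; exists y => //; apply/pplusP; split=> //.
by exists w; apply/pcompP; exists x.
Qed.

Lemma mul_pstar f : f * pstar f = f.
Proof.
apply: pbijP => x y; rewrite pcompP; split=> [[z /pstarP[<-]]|fx] //.
by exists x => //; apply/pstarP; split=> //; exists y.
Qed.

Lemma pstarC f g : pstar f * pstar g = pstar g * pstar f.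
Proof.
by apply: pbijP => x y; rewrite !pcompP; split=> -[z /pstarP[<- ?] /pstarP[<- ?]];
  exists x; apply/pstarP.
Qed.

Lemma pstar_mulr f g : pstar (f * pstar g) = pstar f * pstar g.
Proof.
apply: pbijP => x y; rewrite pstarP pcompP; split.
  move=> [<-] [z /pcompP[x' /pstarP[<- gx] fx]].
  by exists x; apply/pstarP; split=> //; exists z.
move=> [z /pstarP[<- gx] /pstarP[<- [x' fx]]]; split=> //.
by exists x'; apply/pcompP; exists x => //; apply/pstarP.
Qed.

Lemma pstar_ample f g : g * pstar (f * g) = pstar f * g.
Proof.
apply: pbijP => x y; rewrite !pcompP; split.
  move=> [z /pstarP[<- [w /pcompP[v gx fv]]]]; rewrite gx => -[<-].
  by exists v => //; apply/pstarP; split=> //; exists w.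
move=> [z gx /pstarP[<- [w fz]]]; exists x => //; apply/pstarP; split=> //.
by exists w; apply/pcompP; exists z.
Qed.

Lemma pstar_pplus f : pstar (pplus f) = pplus f.
Proof.
apply: pbijP => x y; rewrite pstarP pplusP; split=> -[<-].
  by case=> z /pplusP[_].
by move=> fx; split=> //; exists x; apply/pplusP.
Qed.

Lemma pplus_pstar f : pplus (pstar f) = pstar f.
Proof.
apply: pbijP => x y; rewrite pstarP pplusP; split=> -[<-].
  by case=> z /pstarP[-> ].
by move=> fx; split=> //; exists x; apply/pstarP.
Qed.

HB.instance Definition _ := Semigroup_isRestriction.Build (pbij X)
  pplus_mul pplusC pplus_mull pplus_ample mul_pstar pstarC pstar_mulr
  pstar_ample pstar_pplus pplus_pstar.

Lemma natle_pbijP f g :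
  natle f g <-> forall x y, f x = Some y -> g x = Some y.
Proof.
split=> [[e ->] x y /pcompP[z gx]|fg].
  by rewrite -(rstar_proj e) => /pstarP[<-].
apply/natleP/pbijP => x y; rewrite pcompP; split=> [fx|[z gx]].
  by exists y; [exact: fg | apply/pplusP; split=> //; exists x].
by move=> /pplusP[<- [w fw]]; rewrite (pbij_inj gx (fg _ _ fw)).
Qed.

End SymmetricInverse.

Definition premorphism (S T : restrictionSemigroupType) (phi : S -> T) : Prop :=
  [/\ forall s t, natle (phi s * phi t) (phi (s * t)),
      forall s, natle (rstar (phi s)) (phi (rstar s)) &
      forall s, natle (rplus (phi s)) (phi (rplus s))].

Definition order_ideal (X : semilatticeType) (A : set X) : Prop :=
  forall x y : X, A y -> (x <= y)%O -> A x.

Definition order_iso (X : semilatticeType) (f : pbij X) : Prop :=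
  forall x y x' y' : X, f x = Some x' -> f y = Some y' ->
    (x <= y)%O = (x' <= y')%O.

Record partial_action (S : restrictionSemigroupType) := PartialAction {
  pa_set : semilatticeType;
  pa_act : S -> pbij pa_set;
  pa_p : pa_set -> proj S;
  pa_pI : forall x y, pa_p (x `&` y)%O = (pa_p x `&` pa_p y)%O;
  pa_premorphism : premorphism pa_act;
  pa_A1 : forall s, order_ideal (pdom (pa_act s)) /\
                    order_ideal (pran (pa_act s));
  pa_A2 : forall s, order_iso (pa_act s);
  pa_A3 : forall e : proj S,
    down (pa_p @^-1` [set e]) `<=` pdom (pa_act e) /\
    pdom (pa_act e) `<=` pa_p @^-1` (down [set e]);
  pa_A4 : forall s, pdom (pa_act s) `&` pa_p @^-1` [set starP s] !=set0 }.

Arguments pa_act {S} p s.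
Arguments pa_p {S} p x.

Record pa_morphism (S : restrictionSemigroupType) (a b : partial_action S) :=
  PaMorphism {
  pam :> pa_set a -> pa_set b;
  pamI : forall x y, pam (x `&` y)%O = (pam x `&` pam y)%O;
  pam_M1 : pa_p a = pa_p b \o pam;
  pam_M2 : forall s,
    pam @` pdom (pa_act a s) `<=` pdom (pa_act b s) /\
    (forall x, pdom (pa_act a s) x ->
       pa_act b s (pam x) = omap pam (pa_act a s x)) }.

Section PaCategory.
Variable S : restrictionSemigroupType.

Lemma pa_morphism_eq (a b : partial_action S) (f g : pa_morphism a b) :
  f =1 g -> f = g.
Proof.
case: f g => [f f1 f2 f3] [g g1 g2 g3] /= /funext fg.
case: _ / fg g1 g2 g3 => g1 g2 g3.
by rewrite (Prop_irrelevance f1 g1) (Prop_irrelevance f2 g2)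
  (Prop_irrelevance f3 g3).
Qed.

Lemma pam_act (a b : partial_action S) (f : pa_morphism a b) s x y :
  pa_act a s x = Some y -> pa_act b s (f x) = Some (f y).
Proof.
by move=> xy; rewrite (pam_M2 f s).2 ?xy //; exists y.
Qed.

Lemma pam_p (a b : partial_action S) (f : pa_morphism a b) x :
  pa_p b (f x) = pa_p a x.
Proof. by rewrite (pam_M1 f). Qed.

Lemma pam_M2_intro (a b : partial_action S) (f : pa_set a -> pa_set b) s :
  (forall x y, pa_act a s x = Some y -> pa_act b s (f x) = Some (f y)) ->
  f @` pdom (pa_act a s) `<=` pdom (pa_act b s) /\
  (forall x, pdom (pa_act a s) x -> pa_act b s (f x) = omap f (pa_act a s x)).
Proof.
move=> fs; split=> [_ [x [y /fs fx]] <-|x [y xy]]; first by exists (f y).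
by rewrite xy /= (fs _ _ xy).
Qed.

Definition pa_id (a : partial_action S) : pa_morphism a a :=
  @PaMorphism S a a id (fun _ _ => erefl) erefl
    (fun s => pam_M2_intro (fun _ _ h => h)).

Section Comp.
Variables (a b c : partial_action S).
Variables (g : pa_morphism b c) (f : pa_morphism a b).

Lemma pa_compI x y : g (f (x `&` y)%O) = (g (f x) `&` g (f y))%O.
Proof. by rewrite !pamI. Qed.

Lemma pa_comp_M1 : pa_p a = pa_p c \o (g \o f).
Proof. by apply/funext => x /=; rewrite !pam_p. Qed.

Lemma pa_comp_M2 s x y :
  pa_act a s x = Some y -> pa_act c s (g (f x)) = Some (g (f y)).
Proof. by move=> xy; do 2!apply: pam_act. Qed.

Definition pa_comp : pa_morphism a c := @PaMorphism S a c (g \o f)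
  pa_compI pa_comp_M1 (fun s => pam_M2_intro (@pa_comp_M2 s)).

End Comp.

Fact pa_comp_idl (a b : partial_action S) (f : pa_morphism a b) :
  pa_comp (pa_id b) f = f.
Proof. exact: pa_morphism_eq. Qed.

Fact pa_comp_idr (a b : partial_action S) (f : pa_morphism a b) :
  pa_comp f (pa_id a) = f.
Proof. exact: pa_morphism_eq. Qed.

Fact pa_compA (a b c d : partial_action S)
  (h : pa_morphism c d) (g : pa_morphism b c) (f : pa_morphism a b) :
  pa_comp h (pa_comp g f) = pa_comp (pa_comp h g) f.
Proof. exact: pa_morphism_eq. Qed.

Definition catA : category :=
  @Category (partial_action S) (@pa_morphism S) pa_id pa_comp
    pa_comp_idl pa_comp_idr pa_compA.

Definition A3a (a : partial_action S) : Prop := forall s,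
  pdom (pa_act a s) = [set y | exists t, natle t s /\
    (pdom (pa_act a t) `&` pa_p a @^-1` [set starP t]) y].

Definition A3b (a : partial_action S) : Prop := forall s,
  pdom (pa_act a s) = down (pdom (pa_act a s) `&` pa_p a @^-1` [set starP s]).

Definition catAhat : category := @full_subcategory catA A3a.
Definition catAtilde : category := @full_subcategory catA A3b.

Definition Ihat : functor catAhat catA := @inclF catA A3a.
Definition Itilde : functor catAtilde catA := @inclF catA A3b.

End PaCategory.

Record proper_morphism (S : restrictionSemigroupType) := ProperMorphism {
  pm_dom : restrictionSemigroupType;
  pm_fun :> restrictionMorphism pm_dom S;
  pm_surj : forall s, exists t, pm_fun t = s;
  pm_proper : forall u v, pm_fun u = pm_fun v -> compatible u v }.

Record pm_morphism (S : restrictionSemigroupType) (a b : proper_morphism S) :=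
  PmMorphism {
  pmm :> restrictionMorphism (pm_dom a) (pm_dom b);
  pmm_comm : b \o pmm = a }.

Section PmCategory.
Variable S : restrictionSemigroupType.

Lemma pm_morphism_eq (a b : proper_morphism S) (f g : pm_morphism a b) :
  f =1 g -> f = g.
Proof.
case: f g => [f f1] [g g1] /= /restrictionMorphism_eq fg.
by case: _ / fg g1 => g1; rewrite (Prop_irrelevance f1 g1).
Qed.

Lemma pmmE (a b : proper_morphism S) (f : pm_morphism a b) t : b (f t) = a t.
Proof. by rewrite -[in RHS](pmm_comm f). Qed.

Definition pm_id (a : proper_morphism S) : pm_morphism a a :=
  @PmMorphism S a a idfun erefl.

Fact pm_comp_subproof (a b c : proper_morphism S)
  (g : pm_morphism b c) (f : pm_morphism a b) : c \o (g \o f) = a.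
Proof. by apply/funext => x /=; rewrite !pmmE. Qed.

Definition pm_comp (a b c : proper_morphism S)
    (g : pm_morphism b c) (f : pm_morphism a b) : pm_morphism a c :=
  @PmMorphism S a c (g \o f) (pm_comp_subproof g f).

Fact pm_comp_idl (a b : proper_morphism S) (f : pm_morphism a b) :
  pm_comp (pm_id b) f = f.
Proof. exact: pm_morphism_eq. Qed.

Fact pm_comp_idr (a b : proper_morphism S) (f : pm_morphism a b) :
  pm_comp f (pm_id a) = f.
Proof. exact: pm_morphism_eq. Qed.

Fact pm_compA (a b c d : proper_morphism S)
  (h : pm_morphism c d) (g : pm_morphism b c) (f : pm_morphism a b) :
  pm_comp h (pm_comp g f) = pm_comp (pm_comp h g) f.
Proof. exact: pm_morphism_eq. Qed.

Definition catP : category :=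
  @Category (proper_morphism S) (@pm_morphism S) pm_id pm_comp
    pm_comp_idl pm_comp_idr pm_compA.

End PmCategory.

Section ActionTheory.
Variables (S : restrictionSemigroupType) (a : partial_action S).
Local Notation X := (pa_set a).
Local Notation alpha := (pa_act a).
Local Notation p := (pa_p a).
Implicit Types (s t : S) (x y z : X) (e : proj S).

Lemma act_comp s t x y z :
  alpha t x = Some y -> alpha s y = Some z -> alpha (s * t) x = Some z.
Proof.
move=> xy yz; have [+ _ _] := pa_premorphism a.
by move=> /(_ s t)/natle_pbijP; apply; apply/pcompP; exists y.
Qed.

Lemma act_rstar s x y : alpha s x = Some y -> alpha (rstar s) x = Some x.
Proof.
move=> xy; have [_ + _] := pa_premorphism a.
by move=> /(_ s)/natle_pbijP; apply; apply/pstarP; split=> //; exists y.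
Qed.

Lemma act_rplus s x y : alpha s x = Some y -> alpha (rplus s) y = Some y.
Proof.
move=> xy; have [_ _ +] := pa_premorphism a.
by move=> /(_ s)/natle_pbijP; apply; apply/pplusP; split=> //; exists x.
Qed.

Lemma act_proj e x y : alpha e x = Some y -> y = x.
Proof.
by move=> xy; move/act_rstar: (xy); rewrite rstar_proj xy => -[].
Qed.

Lemma act_down s x y x' : alpha s x = Some y -> (x' <= x)%O ->
  exists2 y', alpha s x' = Some y' & (y' <= y)%O.
Proof.
move=> xy le_x; have [+ _] := pa_A1 a s.
case/(_ x' x _ le_x) => [|y' x'y']; first by exists y.
by exists y' => //; rewrite -(pa_A2 x'y' xy).
Qed.

Lemma act_downV s x y y' : alpha s x = Some y -> (y' <= y)%O ->
  exists2 x', alpha s x' = Some y' & (x' <= x)%O.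
Proof.
move=> xy le_y; have [_ +] := pa_A1 a s.
case/(_ y' y _ le_y) => [|x' x'y']; first by exists x.
by exists x' => //; rewrite (pa_A2 x'y' xy).
Qed.

Lemma act_meet s x y x' y' : alpha s x = Some x' -> alpha s y = Some y' ->
  alpha s (x `&` y)%O = Some (x' `&` y')%O.
Proof.
move=> xx yy; have [z xyz zx] := act_down xx (leIl x y).
have [w wE wx] := act_downV xx (leIl x' y').
have zy : (z <= y')%O by rewrite -(pa_A2 xyz yy) leIr.
have wy : (w <= y)%O by rewrite (pa_A2 wE yy) leIr.
rewrite xyz; congr Some; apply: le_anti; rewrite lexI zx zy /=.
by rewrite -(pa_A2 wE xyz) lexI wx wy.
Qed.

Lemma act_self x : alpha (p x) x = Some x.
Proof.
have [+ _] := pa_A3 a (p x); case/(_ x) => [|y xy]; first by exists x.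
by rewrite xy (act_proj xy).
Qed.

Lemma act_p_proj e x : pdom (alpha e) x -> (p x <= e)%O.
Proof. by have [_ sub] := pa_A3 a e; move=> /sub[_ [->]]. Qed.

Lemma p_le_star s x y : alpha s x = Some y -> (p x <= starP s)%O.
Proof. by move/act_rstar => xx; apply: act_p_proj; exists x. Qed.

Lemma p_le_plus s x y : alpha s x = Some y -> (p y <= plusP s)%O.
Proof. by move/act_rplus => yy; apply: act_p_proj; exists y. Qed.

Lemma p_act s x y : alpha s x = Some y -> p y = plusP (s * pval (p x)).
Proof.
move=> xy; apply: le_anti; rewrite (p_le_plus (act_comp (act_self x) xy)).
have /proj_leP/= h := p_le_star (act_comp xy (act_self y)).
apply/proj_leP => /=; rewrite (projC (plusP _)) /= -rplus_emul.
by rewrite -[in RHS]h (projC (p x) (starP _)) /= !mulgA rstar_emul.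
Qed.

Lemma p_actV s x y : alpha s x = Some y -> p x = starP (pval (p y) * s).
Proof.
move=> xy; apply: le_anti; rewrite (p_le_star (act_comp xy (act_self y))).
have /proj_leP/= h := p_le_plus (act_comp (act_self x) xy).
apply/proj_leP => /=; rewrite -rstar_mule.
by rewrite -mulgA -rplus_mule mulgA h.
Qed.

Lemma p_star s x y : alpha s x = Some y -> p y = plusP s -> p x = starP s.
Proof.
by move=> xy pE; rewrite (p_actV xy) pE; apply/val_inj; rewrite /= rplus_mul.
Qed.

Lemma p_plus s x y : alpha s x = Some y -> p x = starP s -> p y = plusP s.
Proof.
by move=> xy pE; rewrite (p_act xy) pE; apply/val_inj; rewrite /= mul_rstar.
Qed.

Definition pap_pred (z : X * S) : bool :=
  `[< pran (alpha z.2) z.1 /\ p z.1 = plusP z.2 >].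

(** [pap a] is the partial action product of [pa_set a] and [S]. *)
Record pap := Pap { pap_val :> X * S; _ : pap_pred pap_val }.

HB.instance Definition _ := [isSub for pap_val].
HB.instance Definition _ := [Choice of pap by <:].

Implicit Types u v w : pap.

Lemma pap_eq u v : u.1 = v.1 -> u.2 = v.2 -> u = v.
Proof.
by move=> uv1 uv2; apply/val_inj/eqP; rewrite -pair_eqE /= /pair_eq uv1 uv2 !eqxx.
Qed.

Definition pap_inv u : X := pev (pinv (alpha u.2)) u.1.

Lemma pap_invP u : alpha u.2 (pap_inv u) = Some u.1.
Proof.
rewrite /pap_inv; case: u => -[x s] /= /asboolP[[x' xx] _].
by rewrite (pevE (y := x')) //; apply/pinvP.
Qed.

Lemma pap_invE u x : alpha u.2 x = Some u.1 -> pap_inv u = x.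
Proof. exact: (pbij_inj (pap_invP u)). Qed.

Lemma pap_p u : p u.1 = plusP u.2.
Proof. by case: u => u /= /asboolP[]. Qed.

Lemma pap_inv_p u : p (pap_inv u) = starP u.2.
Proof. exact: p_star (pap_invP u) (pap_p u). Qed.

Definition pap_mul_fst u v : X := pev (alpha u.2) (pap_inv u `&` v.1)%O.

Lemma pap_mul_fstP u v :
  alpha u.2 (pap_inv u `&` v.1)%O = Some (pap_mul_fst u v).
Proof.
rewrite /pap_mul_fst; have [y uy _] := act_down (pap_invP u) (leIl _ v.1).
by rewrite uy (pevE uy).
Qed.

Fact pap_mul_subproof u v : pap_pred (pap_mul_fst u v, u.2 * v.2).
Proof.
have uv := pap_mul_fstP u v; apply/asboolP; split=> /=.
  have [x xE _] := act_downV (pap_invP v) (leIr v.1 (pap_inv u)).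
  by exists x; apply: act_comp xE uv.
rewrite (p_act uv) pa_pI pap_inv_p pap_p; apply/val_inj => /=.
by rewrite mulgA mul_rstar -rplusM.
Qed.

Fact pap_star_subproof u : pap_pred (pap_inv u, rstar u.2).
Proof.
apply/asboolP; split=> /=; first by exists (pap_inv u); exact: act_rstar (pap_invP u).
by rewrite pap_inv_p plusP_rstar.
Qed.

Fact pap_plus_subproof u : pap_pred (u.1, rplus u.2).
Proof.
apply/asboolP; split=> /=; first by exists u.1; exact: act_rplus (pap_invP u).
by rewrite pap_p plusP_rplus.
Qed.

Definition pap_mul u v : pap := Pap (pap_mul_subproof u v).
Definition pap_star u : pap := Pap (pap_star_subproof u).
Definition pap_plus u : pap := Pap (pap_plus_subproof u).

Lemma pap_mul_fst_eq u v x :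
  alpha u.2 (pap_inv u `&` v.1)%O = Some x -> (pap_mul u v).1 = x.
Proof. by rewrite pap_mul_fstP => -[]. Qed.

Lemma pap_inv_mulP u v :
  alpha v.2 (pap_inv (pap_mul u v)) = Some (pap_inv u `&` v.1)%O.
Proof.
have [x xE _] := act_downV (pap_invP v) (leIr v.1 (pap_inv u)).
by rewrite (pap_invE (x := x)) //=; apply: act_comp xE (pap_mul_fstP u v).
Qed.

Lemma pap_inv_mul_le u v : (pap_inv (pap_mul u v) <= pap_inv v)%O.
Proof. by rewrite (pa_A2 (pap_inv_mulP u v) (pap_invP v)) leIr. Qed.

Lemma pap_mul_le u v : ((pap_mul u v).1 <= u.1)%O.
Proof. by rewrite -(pa_A2 (pap_mul_fstP u v) (pap_invP u)) leIl. Qed.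

Lemma pap_inv_proj u (e : proj S) : u.2 = pval e -> pap_inv u = u.1.
Proof. by move=> uE; have := pap_invP u; rewrite uE => /act_proj. Qed.

Lemma pap_inv_star u : pap_inv (pap_star u) = pap_inv u.
Proof. exact: (pap_inv_proj (e := starP u.2)). Qed.

Lemma pap_inv_plus u : pap_inv (pap_plus u) = u.1.
Proof. exact: (pap_inv_proj (e := plusP u.2)). Qed.

Lemma pap_mul_proj (e : proj S) u v : u.2 = pval e ->
  (pap_mul u v).1 = (u.1 `&` v.1)%O.
Proof.
move=> uE; have := pap_mul_fstP u v; rewrite (pap_inv_proj uE) uE.
exact: act_proj.
Qed.

Lemma pap_mulA : associative pap_mul.
Proof.
move=> u v w; apply: pap_eq; last by rewrite /= mulgA.
apply: esym; apply: pap_mul_fst_eq; apply: act_comp (pap_mul_fstP _ _).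
rewrite -(meet_l (pap_inv_mul_le u v)) -meetA.
rewrite (act_meet (pap_inv_mulP u v) (pap_mul_fstP v w)) -meetA.
by rewrite (meet_r (pap_mul_le v w)).
Qed.

HB.instance Definition _ := isSemigroup.Build pap pap_mulA.

Lemma pap_plus_mul u : pap_mul (pap_plus u) u = u.
Proof.
apply: pap_eq; last by rewrite /= rplus_mul.
by rewrite (@pap_mul_proj (plusP u.2) _ _ _) //= meetxx.
Qed.

Lemma pap_plusC u v :
  pap_mul (pap_plus u) (pap_plus v) = pap_mul (pap_plus v) (pap_plus u).
Proof.
apply: pap_eq; last by rewrite /= rplusC.
rewrite (@pap_mul_proj (plusP u.2) _ _ _) // (@pap_mul_proj (plusP v.2) _ _ _) //=.
exact: meetC.
Qed.

Lemma pap_plus_mull u v :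
  pap_plus (pap_mul (pap_plus u) v) = pap_mul (pap_plus u) (pap_plus v).
Proof.
apply: pap_eq; last by rewrite /= rplus_mull.
rewrite [RHS](@pap_mul_proj (plusP u.2) _ _ _) //.
exact: (@pap_mul_proj (plusP u.2) _ _ _).
Qed.

Lemma pap_plus_ample u v :
  pap_mul (pap_plus (pap_mul u v)) u = pap_mul u (pap_plus v).
Proof.
apply: pap_eq; last by rewrite /= rplus_ample.
rewrite (@pap_mul_proj (plusP (u.2 * v.2)) _ _ _) //.
by rewrite (meet_l (pap_mul_le u v)).
Qed.

Lemma pap_mul_star u : pap_mul u (pap_star u) = u.
Proof.
apply: pap_eq; last by rewrite /= mul_rstar.
by apply: pap_mul_fst_eq; rewrite meetxx pap_invP.
Qed.

Lemma pap_starC u v :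
  pap_mul (pap_star u) (pap_star v) = pap_mul (pap_star v) (pap_star u).
Proof.
apply: pap_eq; last by rewrite /= rstarC.
rewrite (@pap_mul_proj (starP u.2) _ _ _) // (@pap_mul_proj (starP v.2) _ _ _) //=.
exact: meetC.
Qed.

Lemma pap_star_mulr u v :
  pap_star (pap_mul u (pap_star v)) = pap_mul (pap_star u) (pap_star v).
Proof.
apply: pap_eq; last by rewrite /= rstar_mulr.
rewrite [RHS](@pap_mul_proj (starP u.2) _ _ _) //=.
exact: esym (@act_proj (starP v.2) _ _ (pap_inv_mulP u (pap_star v))).
Qed.

Lemma pap_star_ample u v :
  pap_mul v (pap_star (pap_mul u v)) = pap_mul (pap_star u) v.
Proof.
apply: pap_eq; last by rewrite /= rstar_ample.
rewrite [RHS](@pap_mul_proj (starP u.2) _ _ _) //; apply: pap_mul_fst_eq.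
by rewrite (meet_r (pap_inv_mul_le u v)) pap_inv_mulP.
Qed.

Lemma pap_star_plus u : pap_star (pap_plus u) = pap_plus u.
Proof. by apply: pap_eq; rewrite /= ?rstar_rplus ?pap_inv_plus. Qed.

Lemma pap_plus_star u : pap_plus (pap_star u) = pap_star u.
Proof. by apply: pap_eq; rewrite /= ?rplus_rstar. Qed.

HB.instance Definition _ := Semigroup_isRestriction.Build pap
  pap_plus_mul pap_plusC pap_plus_mull pap_plus_ample pap_mul_star pap_starC
  pap_star_mulr pap_star_ample pap_star_plus pap_plus_star.

Definition pap_snd (u : pap) : S := u.2.

HB.instance Definition _ :=
  isMultiplicative.Build pap S pap_snd (fun _ _ => erefl).
HB.instance Definition _ :=
  isRestrictionMorphism.Build pap S pap_snd (fun _ => erefl) (fun _ => erefl).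

Fact pap_snd_surj s : exists u, pap_snd u = s.
Proof.
have [x [[y xy] /= px]] := pa_A4 a s.
have h : pap_pred (y, s).
  by apply/asboolP; split; [exists x | exact: p_plus xy px].
by exists (Pap h).
Qed.

Fact pap_snd_proper u v : pap_snd u = pap_snd v -> compatible u v.
Proof.
rewrite /pap_snd => uv; split; apply: pap_eq; last by rewrite /= uv.
- apply: (@pap_mul_fst_eq u (pap_star v)); rewrite /= uv meetC.
  exact: (pap_mul_fstP v (pap_star u)).
- by rewrite /= uv.
rewrite [LHS](@pap_mul_proj (plusP v.2) (pap_plus v) u erefl) meetC.
exact: esym (@pap_mul_proj (plusP u.2) (pap_plus u) v erefl).
Qed.

Definition U_obj : proper_morphism S :=
  @ProperMorphism S pap pap_snd pap_snd_surj pap_snd_proper.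

End ActionTheory.

Section UMor.
Variables (S : restrictionSemigroupType) (a b : partial_action S).
Variable f : pa_morphism a b.

Fact U_mor_subproof (u : pap a) : pap_pred (a := b) (f u.1, u.2).
Proof.
apply/asboolP; split=> /=; last by rewrite pam_p pap_p.
by exists (f (pap_inv u)); apply: pam_act; exact: pap_invP.
Qed.

Definition U_mor_fun (u : pap a) : pap b := Pap (U_mor_subproof u).

Lemma U_mor_inv u : pap_inv (U_mor_fun u) = f (pap_inv u).
Proof. by apply: pap_invE => /=; apply: pam_act; exact: pap_invP. Qed.

Fact U_morM : {morph U_mor_fun : u v / u * v}.
Proof.
move=> u v; apply: pap_eq => //=.
apply: esym; apply: (pap_mul_fst_eq (u := U_mor_fun u) (v := U_mor_fun v)).
by rewrite U_mor_inv /= -pamI; apply: pam_act; exact: pap_mul_fstP.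
Qed.

Fact U_mor_star : {morph U_mor_fun : u / rstar u}.
Proof. by move=> u; apply: pap_eq => //=; rewrite U_mor_inv. Qed.

Fact U_mor_plus : {morph U_mor_fun : u / rplus u}.
Proof. by move=> u; apply: pap_eq. Qed.

HB.instance Definition _ :=
  isMultiplicative.Build (pap a) (pap b) U_mor_fun U_morM.
HB.instance Definition _ :=
  isRestrictionMorphism.Build (pap a) (pap b) U_mor_fun U_mor_star U_mor_plus.

Definition U_mor : pm_morphism (U_obj a) (U_obj b) :=
  @PmMorphism S (U_obj a) (U_obj b) U_mor_fun erefl.

End UMor.

Section UFunctor.
Variable S : restrictionSemigroupType.

Fact U_id (a : catA S) : U_mor (pa_id a) = pm_id (U_obj a).
Proof. by apply: pm_morphism_eq => u; apply: pap_eq. Qed.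

Fact U_comp (a b c : catA S) (g : pa_morphism b c) (f : pa_morphism a b) :
  U_mor (pa_comp g f) = pm_comp (U_mor g) (U_mor f).
Proof. by apply: pm_morphism_eq => u; apply: pap_eq. Qed.

Definition U : functor (catA S) (catP S) :=
  @Functor (catA S) (catP S) (@U_obj S) (@U_mor S) U_id U_comp.

Definition Utilde : functor (catAtilde S) (catP S) := compF U (Itilde S).

End UFunctor.

Section FtildeObj.
Variables (S : restrictionSemigroupType) (a : partial_action S).
Local Notation X := (pa_set a).
Local Notation alpha := (pa_act a).
Local Notation p := (pa_p a).

(** The domain of the restricted action at [s] is [down (core s)]. *)
Definition core s : set X := pdom (alpha s) `&` p @^-1` [set starP s].

Definition Ft_act s : pbij X := prestr (alpha s) (down (core s)).

Lemma Ft_actP s x y :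
  Ft_act s x = Some y <-> down (core s) x /\ alpha s x = Some y.
Proof. exact: prestrP. Qed.

Lemma Ft_act_dom s x : down (core s) x -> pdom (Ft_act s) x.
Proof.
move=> xs; have [x0 [[[y x0y] _] le_x]] := xs.
by have [y' xy' _] := act_down x0y le_x; exists y'; apply/Ft_actP.
Qed.

Lemma core_dom s x : core s x -> down (core s) x.
Proof. by move=> ?; exists x. Qed.

Fact Ft_premorphism : premorphism Ft_act.
Proof.
split=> [s t|s|s]; apply/natle_pbijP => x z.
- move=> /pcompP[y /Ft_actP[[x0 [[[y1 x0y1] /= px0] le_x]] xy]].
  move=> /Ft_actP[[y0 [[[z0 y0z0] /= py0] le_y]] yz].
  apply/Ft_actP; split; last exact: act_comp xy yz.
  have le_y1 : (y <= y1)%O by rewrite -(pa_A2 xy x0y1).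
  have [w wE le_w] := act_downV x0y1 (leIl y1 y0).
  have [z' z'E _] := act_down y0z0 (leIr y0 y1).
  exists w; split; last by rewrite (pa_A2 xy wE) lexI le_y1.
  split; first by exists z'; exact: act_comp wE z'E.
  rewrite /= (p_actV wE) pa_pI py0 (p_plus x0y1 px0); apply/val_inj => /=.
  by rewrite (projC (plusP t) (starP s)) /= -mulgA rplus_mul -rstarM.
- move=> /pstarP[<- [y /Ft_actP[[x0 [[[y0 x0y0] /= px0] le_x]] xy]]].
  apply/Ft_actP; split; last exact: act_rstar xy.
  exists x0; split=> //; split; first by exists x0; exact: act_rstar x0y0.
  by rewrite /= starP_rstar.
- move=> /pplusP[<- [y /Ft_actP[[y0 [[[x0 y0x0] /= py0] le_y]] yx]]].
  apply/Ft_actP; split; last exact: act_rplus yx.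
  exists x0; split; last by rewrite -(pa_A2 yx y0x0).
  split; first by exists x0; exact: act_rplus y0x0.
  by rewrite /= starP_rplus (p_plus y0x0).
Qed.

Fact Ft_A1 s : order_ideal (pdom (Ft_act s)) /\ order_ideal (pran (Ft_act s)).
Proof.
split=> [x' x [y /Ft_actP[[x0 [x0s le_x]] _]] le_x'|].
  by apply: Ft_act_dom; exists x0; split=> //; apply: le_trans le_x.
move=> y' y [x /Ft_actP[[x0 [x0s le_x]] xy]] le_y'.
have [x' x'y' le_x'] := act_downV xy le_y'.
exists x'; apply/Ft_actP; split=> //.
by exists x0; split=> //; apply: le_trans le_x.
Qed.

Fact Ft_A2 s : order_iso (Ft_act s).
Proof. by move=> x y x' y' /Ft_actP[_ xx'] /Ft_actP[_ yy']; apply: pa_A2 yy'. Qed.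

Fact Ft_A3 (e : proj S) : down (p @^-1` [set e]) `<=` pdom (Ft_act e) /\
  pdom (Ft_act e) `<=` p @^-1` (down [set e]).
Proof.
split=> [x [x0 [/= px0 le_x]]|x [y /Ft_actP[_ xy]]].
  apply: Ft_act_dom; exists x0; split=> //; split=> /=.
    by exists x0; rewrite -px0; exact: act_self.
  by rewrite starP_proj.
by have [_] := pa_A3 a e; apply; exists y.
Qed.

Lemma Ft_core s : pdom (Ft_act s) `&` p @^-1` [set starP s] = core s.
Proof.
apply/seteqP; split=> [x [[y /Ft_actP[_ xy]] px]|x xs].
  by split=> //; exists y.
by split; [apply/Ft_act_dom/core_dom | case: xs].
Qed.

Fact Ft_A4 s : pdom (Ft_act s) `&` p @^-1` [set starP s] !=set0.
Proof. by rewrite Ft_core; exact: pa_A4. Qed.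

Definition Ft_pa : partial_action S :=
  @PartialAction S X Ft_act p (pa_pI (p := a))
    Ft_premorphism Ft_A1 Ft_A2 Ft_A3 Ft_A4.

Fact Ft_A3b : A3b Ft_pa.
Proof.
move=> s /=; rewrite Ft_core; apply/seteqP; split=> [x [y /Ft_actP[]]|x] //.
exact: Ft_act_dom.
Qed.

Definition Ft_obj : catAtilde S := exist _ Ft_pa Ft_A3b.

End FtildeObj.

Section FtildeMor.
Variables (S : restrictionSemigroupType) (a b : partial_action S).
Variable f : pa_morphism a b.

Lemma pam_le x y : (x <= y)%O -> (f x <= f y)%O.
Proof. by move=> /meet_l xy; apply/meet_idPl; rewrite -pamI xy. Qed.

Fact Ft_M2 s x y :
  @Ft_act S a s x = Some y -> @Ft_act S b s (f x) = Some (f y).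
Proof.
move=> /Ft_actP[[x0 [[[y0 x0y0] /= px0] le_x]] xy].
apply/Ft_actP; split; last exact: pam_act.
exists (f x0); split; last exact: pam_le.
by split; [exists (f y0); exact: pam_act | rewrite /= pam_p].
Qed.

Definition Ft_mor : pa_morphism (Ft_pa a) (Ft_pa b) :=
  @PaMorphism S (Ft_pa a) (Ft_pa b) f (pamI f) (pam_M1 f)
    (fun s => @pam_M2_intro S (Ft_pa a) (Ft_pa b) f s (@Ft_M2 s)).

End FtildeMor.

Section FtildeFunctor.
Variable S : restrictionSemigroupType.

Fact Ft_id (a : catA S) : Ft_mor (pa_id a) = pa_id (Ft_pa a).
Proof. exact: pa_morphism_eq. Qed.

Fact Ft_comp (a b c : catA S) (g : pa_morphism b c) (f : pa_morphism a b) :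
  Ft_mor (pa_comp g f) = pa_comp (Ft_mor g) (Ft_mor f).
Proof. exact: pa_morphism_eq. Qed.

Definition Ftilde : functor (catA S) (catAtilde S) :=
  @Functor (catA S) (catAtilde S) (@Ft_obj S) (@Ft_mor S) Ft_id Ft_comp.

End FtildeFunctor.

Section GhatObj.
Variables (S : restrictionSemigroupType) (psi : proper_morphism S).
Local Notation T := (pm_dom psi).
Implicit Types (s : S) (t u v : T) (e f : proj T).

Lemma natle_psi t u : natle t u -> natle (psi t) (psi u).
Proof.
move=> /natleP ->; exists (plusP (psi t)).
by rewrite rmM rmplus.
Qed.

Definition Gh_index s e t : Prop := (e <= starP t)%O /\ natle (psi t) s.

Definition Gh_fun s e : option (proj T) :=
  if pselect (exists t, Gh_index s e t) is left h
  then Some (plusP (sval (cid h) * pval e)) else None.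

Lemma compat_star u v : compatible u v -> rstar u = rstar v -> u = v.
Proof. by case=> + _ uv; rewrite -uv mul_rstar uv mul_rstar. Qed.

Lemma compat_plus u v : compatible u v -> rplus u = rplus v -> u = v.
Proof. by case=> _ + uv; rewrite -uv rplus_mul uv rplus_mul. Qed.

Lemma Gh_index_mul s e t : Gh_index s e t ->
  rstar (t * pval e) = e /\ psi (t * pval e) = s * rstar (psi e).
Proof.
move=> [/proj_leP/= et /natlePr ts].
have E : rstar t * pval e = pval e by rewrite -[RHS]et (projC e (starP t)).
split; first by rewrite rstar_mule.
by rewrite rmM ts -rmstar -mulgA -rmM E -rmstar rstar_proj.
Qed.

(** The value of [Gh_fun] does not depend on the chosen [t]. *)
Lemma Gh_funE s e t : Gh_index s e t -> Gh_fun s e = Some (plusP (t * pval e)).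
Proof.
move=> et; rewrite /Gh_fun; case: pselect => [h|[]]; last by exists t.
case: (cid h) => u /= eu; congr (Some (plusP _)).
have [s1 p1] := Gh_index_mul et; have [s2 p2] := Gh_index_mul eu.
by apply: compat_star; [apply: pm_proper; rewrite p1 p2 | rewrite s1 s2].
Qed.

Lemma Gh_fun_dom s e : (exists f, Gh_fun s e = Some f) <-> exists t, Gh_index s e t.
Proof.
split=> [[f]|[t et]]; first by rewrite /Gh_fun; case: pselect.
by exists (plusP (t * pval e)); exact: Gh_funE.
Qed.

Lemma Gh_funP s e f : Gh_fun s e = Some f <->
  exists u, [/\ natle (psi u) s, starP u = e & plusP u = f].
Proof.
split=> [ef|[u [us <- <-]]]; last first.
  by rewrite (@Gh_funE _ _ u) //= mul_rstar.
have [|t et] := (Gh_fun_dom s e).1; first by exists f.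
move: ef; rewrite (Gh_funE et) => -[<-].
have [se _] := Gh_index_mul et; exists (t * pval e); split=> //.
  by apply: natle_trans et.2; apply: natle_psi; exact: natle_mule.
exact/val_inj.
Qed.

Fact Gh_inj s : pinjective (Gh_fun s).
Proof.
apply/asboolP => e1 e2 f /Gh_funP[u [us <- uf]] /Gh_funP[v [vs <- vf]].
have uv : rplus u = rplus v by rewrite -[LHS]/(pval (plusP u)) uf -vf.
congr starP; apply: compat_plus (uv); apply: pm_proper.
move/natleP: us => ->; move/natleP: vs => ->.
by rewrite -!rmplus uv.
Qed.

Definition Gh_act s : pbij (proj T) := PBij (Gh_inj s).

Fact Gh_p_subproof e : is_proj (psi (pval e)).
Proof. by apply/is_projP; rewrite -rmstar rstar_proj. Qed.

Definition Gh_p e : proj S := Proj (Gh_p_subproof e).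

Lemma Gh_pE e : pval (Gh_p e) = psi (pval e). Proof. by []. Qed.

Lemma Gh_p_star u : Gh_p (starP u) = starP (psi u).
Proof. by apply: proj_inj; rewrite Gh_pE /= rmstar. Qed.

Fact Gh_pI e f : Gh_p (e `&` f)%O = (Gh_p e `&` Gh_p f)%O.
Proof. by apply: proj_inj; rewrite Gh_pE !proj_meetE !Gh_pE rmM. Qed.

Fact Gh_premorphism : premorphism Gh_act.
Proof.
split=> [s t|s|s]; apply/natle_pbijP => e g.
- move=> /pcompP[f /Gh_funP[u [ut ue uf]] /Gh_funP[v [vs vf vg]]].
  have uv : rplus u = rstar v by rewrite -[LHS]/(pval (plusP u)) uf -vf.
  apply/Gh_funP; exists (v * u); split.
  + by rewrite rmM; exact: natle_mul.
  + by rewrite -ue; apply/val_inj; rewrite /= rstarM -uv rplus_mul.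
  + by rewrite -vg; apply/val_inj; rewrite /= rplusM uv mul_rstar.
- move=> /pstarP[<- [f /Gh_funP[u [us ue uf]]]].
  apply/Gh_funP; exists (rstar u).
  rewrite rmstar starP_rstar plusP_rstar; split=> //.
  exact: natle_rstar.
- move=> /pplusP[<- [f /Gh_funP[u [us ue uf]]]].
  apply/Gh_funP; exists (rplus u).
  rewrite rmplus starP_rplus plusP_rplus; split=> //.
  exact: natle_rplus.
Qed.

Fact Gh_A1 s : order_ideal (pdom (Gh_act s)) /\ order_ideal (pran (Gh_act s)).
Proof.
split=> [e e0 [f /Gh_funP[u [us ue uf]]]|f f0 [e /Gh_funP[u [us ue uf]]]] /proj_leP le.
  exists (plusP (u * pval e)); apply/Gh_funP; exists (u * pval e); split=> //.
    by apply: natle_trans us; apply: natle_psi; exact: natle_mule.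
  by apply/val_inj; rewrite /= rstar_mule -[rstar u]/(pval (starP u)) ue projC.
exists (starP (pval f * u)); apply/Gh_funP; exists (pval f * u); split=> //.
  by apply: natle_trans us; apply: natle_psi; exact: natle_emul.
by apply/val_inj; rewrite /= rplus_emul -[rplus u]/(pval (plusP u)) uf.
Qed.

Fact Gh_A2 s : order_iso (Gh_act s).
Proof.
have h u v : natle (psi u) s -> natle (psi v) s ->
    (starP u <= starP v)%O -> (plusP u <= plusP v)%O.
  move=> us vs uv.
  have i : Gh_index s (starP u) v by split.
  have j : Gh_index s (starP u) u by split.
  move: (Gh_funE i); rewrite (Gh_funE j) /= mul_rstar => -[uE].
  by apply/proj_leE; rewrite /= uE; apply: natle_rplus (natle_mule v (starP u)).
have k u v : natle (psi u) s -> natle (psi v) s ->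
    (plusP u <= plusP v)%O -> (starP u <= starP v)%O.
  move=> us vs /proj_leP/= uv.
  have E : rplus (rplus u * v) = rplus u by rewrite rplus_mull.
  suff uE : u = rplus u * v.
    apply/proj_leE; rewrite /= uE.
    exact: natle_rstar (natle_emul (plusP u) v).
  apply: compat_plus (esym E); apply: pm_proper.
  rewrite rmM rmplus.
  move/natleP: us => {1}->; move/natleP: vs => ->.
  by rewrite mulgA -!rmplus -rmM uv.
move=> e e' f f' /Gh_funP[u [us <- <-]] /Gh_funP[v [vs <- <-]].
by apply/idP/idP; [exact: h | exact: k].
Qed.

Fact Gh_A3 (e : proj S) : down (Gh_p @^-1` [set e]) `<=` pdom (Gh_act e) /\
  pdom (Gh_act e) `<=` Gh_p @^-1` (down [set e]).
Proof.
split=> [x [y [/= ye xy]]|x [y /Gh_funP[u [ue <- _]]]] /=.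
  exists x; apply/Gh_funP; exists (pval x); split.
  - by rewrite -ye Gh_pE; apply/natle_psi/proj_leE.
  - exact: starP_proj.
  - exact: plusP_proj.
exists e; split=> //; rewrite Gh_p_star -(starP_proj e).
by apply/proj_leE; exact: natle_rstar.
Qed.

Fact Gh_A4 s : pdom (Gh_act s) `&` Gh_p @^-1` [set starP s] !=set0.
Proof.
have [u us] := pm_surj psi s; exists (starP u); split; last first.
  by rewrite /= Gh_p_star us.
by exists (plusP u); apply/Gh_funP; exists u; split=> //; rewrite us; exact: natle_refl.
Qed.

Definition Gh_pa : partial_action S :=
  @PartialAction S (proj T) Gh_act Gh_p Gh_pI
    Gh_premorphism Gh_A1 Gh_A2 Gh_A3 Gh_A4.

Fact Gh_A3a : A3a Gh_pa.
Proof.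
move=> s /=; apply/seteqP; split=> e.
  move=> [f /Gh_funP[u [us <- uf]]]; exists (psi u); split=> //; split.
    by exists f; apply/Gh_funP; exists u; split=> //; exact: natle_refl.
  exact: Gh_p_star.
move=> [t [ts [[f /Gh_funP[u [ut ue uf]]] _]]].
by exists f; apply/Gh_funP; exists u; split=> //; exact: natle_trans ts.
Qed.

Definition Gh_obj : catAhat S := exist _ Gh_pa Gh_A3a.

End GhatObj.

Section GhatMor.
Variables (S : restrictionSemigroupType) (a b : proper_morphism S).
Variable g : pm_morphism a b.

Fact Gh_mor_subproof (e : proj (pm_dom a)) : is_proj (g (pval e)).
Proof. by apply/is_projP; rewrite -rmstar rstar_proj. Qed.

Definition Gh_mor_fun (e : proj (pm_dom a)) : proj (pm_dom b) :=
  Proj (Gh_mor_subproof e).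

Fact Gh_morI e f : Gh_mor_fun (e `&` f)%O = (Gh_mor_fun e `&` Gh_mor_fun f)%O.
Proof. by apply: proj_inj; rewrite proj_meetE /= rmM. Qed.

Fact Gh_mor_M1 : pa_p (Gh_pa a) = pa_p (Gh_pa b) \o Gh_mor_fun.
Proof. by apply/funext => e; apply: proj_inj; rewrite /= pmmE. Qed.

Fact Gh_mor_M2 s x y : @Gh_act S a s x = Some y ->
  @Gh_act S b s (Gh_mor_fun x) = Some (Gh_mor_fun y).
Proof.
move=> /Gh_funP[u [us <- <-]]; apply/Gh_funP; exists (g u); split.
- by rewrite pmmE.
- by apply/val_inj; rewrite /= rmstar.
- by apply/val_inj; rewrite /= rmplus.
Qed.

Definition Gh_mor : pa_morphism (Gh_pa a) (Gh_pa b) :=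
  @PaMorphism S (Gh_pa a) (Gh_pa b) Gh_mor_fun Gh_morI Gh_mor_M1
    (fun s => @pam_M2_intro S (Gh_pa a) (Gh_pa b) Gh_mor_fun s (@Gh_mor_M2 s)).

End GhatMor.

Section GhatFunctor.
Variable S : restrictionSemigroupType.

Fact Gh_id (a : catP S) : Gh_mor (pm_id a) = pa_id (Gh_pa a).
Proof. by apply: pa_morphism_eq => e; exact/val_inj. Qed.

Fact Gh_comp (a b c : catP S) (g : pm_morphism b c) (f : pm_morphism a b) :
  Gh_mor (pm_comp g f) = pa_comp (Gh_mor g) (Gh_mor f).
Proof. by apply: pa_morphism_eq => e; exact/val_inj. Qed.

Definition Ghat : functor (catP S) (catAhat S) :=
  @Functor (catP S) (catAhat S) (@Gh_obj S) (@Gh_mor S) Gh_id Gh_comp.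

Definition Gtilde : functor (catP S) (catAtilde S) :=
  compF (Ftilde S) (compF (Ihat S) Ghat).

End GhatFunctor.

(* Main.v *)
Require Import Defs.
From HB Require Import structures.
From mathcomp Require Import all_boot all_order.
From mathcomp Require Import boolp classical_sets.

(** A partial action product [X ><| S] remembers the semilattice [X]: its
    projections are the pairs [(x, p x)], so [x |-> (x, p x)] identifies [X]
    with [P(X ><| S)].  Conversely, an element [t] of a proper cover
    [psi : T -> S] is determined by the pair [(t^+, psi t)], because two
    elements with the same image are compatible, and compatible elements with
    the same [^+] are equal.  Everything follows from these two observations.

    On the side of [P(S)], [t |-> (t^+, psi t)] is an isomorphism from [psi] to
    [U (Gtilde psi)] ([Gtilde_unit_bij]).  Restricting an action by [Ftilde]
    does not change its product, as the product only uses the part of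
    [dom alpha_s] lying over [s^*], and that part is kept ([U_Ft_incl_bij]).
    So the same formula also gives an isomorphism from [psi] to [U (Ghat psi)].

    On the side of [A(S)], [x |-> (x, p x)] is always a morphism
    [a -> Ghat (U a)]: if [alpha_s x = y], the element [(y, s p(x))] of the
    product lies over something below [s] and carries [(x, p x)] to [(y, p y)].
    Its inverse on points need not respect the action of [Ghat (U a)], whose
    domain at [s] contains every [x] that lies in [dom alpha_t] and over [t^*]
    for some [t <= s], even when [x] is not in [dom alpha_s].  After
    restriction by [Ftilde] only points below a point of [dom alpha_s] over
    [s^*] remain; these are in [dom alpha_s], and
    [(x, e) |-> x] becomes a morphism [Gtilde (U a) -> a] ([Gtilde_counit]).
    It is an isomorphism when the domains of [a] are already of that form,
    that is, under (A3b) ([Gtilde_counit_iso]).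

    Hence [Utilde] and [Gtilde] are mutually inverse up to isomorphism.  The
    maps [Ghat_unit] and the inverse of [psi -> U (Ghat psi)] are the unit and
    counit of the adjunction with [U] on the left; [Gtilde_unit] and
    [Gtilde_counit] are the unit and counit of the one with [U] on the right.
    All triangle identities reduce to comparing the pairs written above. *)

Set Implicit Arguments.
Unset Strict Implicit.
Unset Printing Implicit Defensive.

Import Order.TTheory.

Local Open Scope group_scope.
Local Open Scope classical_set_scope.

(** * Natural transformations and adjunctions *)

Definition natural (C D : category) (F G : functor C D)
    (eta : forall a, hom (F a) (G a)) :=
  forall (a b : C) (f : hom a b),
    compm (eta b) (fmap F f) = compm (fmap G f) (eta a).

Lemma natural_inverse (C D : category) (F G : functor C D)
    (eta : forall a, hom (F a) (G a)) :
  natural eta -> (forall a, is_iso (eta a)) ->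
  exists eps : forall a, hom (G a) (F a),
    [/\ natural eps, forall a, compm (eps a) (eta a) = idm (F a)
      & forall a, compm (eta a) (eps a) = idm (G a)].
Proof.
move=> etaN etaI; pose eps a := sval (cid (etaI a)).
have epsK a : compm (eps a) (eta a) = idm (F a) by case: (svalP (cid (etaI a))).
have etaK a : compm (eta a) (eps a) = idm (G a) by case: (svalP (cid (etaI a))).
exists eps; split=> // a b f.
rewrite -[LHS]compm1r -(etaK a) compmA -(compmA (eps b)) -etaN.
by rewrite (compmA (eps b)) epsK compm1l.
Qed.

Lemma nat_iso_inverse (C D : category) (F G : functor C D)
    (eta : forall a, hom (F a) (G a)) :
  natural eta -> (forall a, is_iso (eta a)) -> nat_iso G F.
Proof.
move=> etaN etaI; have [eps [epsN epsK etaK]] := natural_inverse etaN etaI.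
by exists eps; split=> // a; exists (eta a).
Qed.

Lemma unit_counit_adjoint (C D : category) (L : functor C D) (R : functor D C)
    (eta : forall c, hom (idF C c) (compF R L c))
    (eps : forall d, hom (compF L R d) (idF D d)) :
  natural (F := idF C) (G := compF R L) eta ->
  natural (F := compF L R) (G := idF D) eps ->
  (forall c, compm (eps (L c)) (fmap L (eta c)) = idm (L c)) ->
  (forall d, compm (fmap R (eps d)) (eta (R d)) = idm (R d)) ->
  left_adjoint L R.
Proof.
move=> etaN epsN triL triR.
exists (fun c d f => compm (fmap R f) (eta c)); split.
  move=> c d; exists (fun g => compm (eps d) (fmap L g)) => [f|g].
    rewrite fmap_comp compmA.
    by have /= -> := epsN _ _ f; rewrite -compmA triL compm1r.
  rewrite fmap_comp -compmA.
  by have /= <- := etaN _ _ g; rewrite compmA triR compm1l.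
move=> c c' d d' h k f; rewrite !fmap_comp -!compmA.
by have /= <- := etaN _ _ h.
Qed.

Lemma is_iso_comp (C : category) (a b c : C) (g : hom b c) (f : hom a b) :
  is_iso g -> is_iso f -> is_iso (compm g f).
Proof.
move=> [g' [g'K gK]] [f' [f'K fK]]; exists (compm f' g'); split.
  by rewrite compmA -(compmA f') g'K compm1r.
by rewrite compmA -(compmA g) fK compm1r.
Qed.

(** * Bijective morphisms of proper covers *)

Section BijectiveProperMorphism.
Variables (S : restrictionSemigroupType) (a b : proper_morphism S).
Variables (f : pm_morphism a b) (g : pm_dom b -> pm_dom a).

(** A copy of [g] that records the cancellation proofs, so that the restriction
    morphism structure, which depends on them, can be attached to it. *)
Definition pm_inv_fun of cancel f g & cancel g f := g.

Hypotheses (fK : cancel f g) (gK : cancel g f).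
Local Notation h := (pm_inv_fun fK gK).

Fact pm_inv_mul : {morph h : x y / x * y}.
Proof. by move=> x y; rewrite /h -{1}(gK x) -{1}(gK y) -rmM fK. Qed.

Fact pm_inv_star : {morph h : x / rstar x}.
Proof. by move=> x; rewrite /h -{1}(gK x) -rmstar fK. Qed.

Fact pm_inv_plus : {morph h : x / rplus x}.
Proof. by move=> x; rewrite /h -{1}(gK x) -rmplus fK. Qed.

HB.instance Definition _ :=
  isMultiplicative.Build (pm_dom b) (pm_dom a) h pm_inv_mul.
HB.instance Definition _ :=
  isRestrictionMorphism.Build (pm_dom b) (pm_dom a) h pm_inv_star pm_inv_plus.

Fact pm_inv_comm : a \o h = b.
Proof. by apply/funext => x; rewrite /= /h -(pmmE f) gK. Qed.

Definition pm_inv : pm_morphism b a := PmMorphism pm_inv_comm.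

End BijectiveProperMorphism.

Lemma pm_bij_iso (S : restrictionSemigroupType) (a b : catP S) (f : hom a b) :
  bijective (f : pm_morphism a b) -> is_iso f.
Proof.
move=> [g fK gK]; exists (pm_inv fK gK).
by split; apply: pm_morphism_eq => x; [apply: fK | apply: gK].
Qed.

(** * Restriction by [Ftilde] preserves the product *)

Section FtildeInclusion.
Variables (S : restrictionSemigroupType) (b : partial_action S).

Fact Ft_incl_M2 s x y : Ft_act b s x = Some y -> pa_act b s x = Some y.
Proof. by case/Ft_actP. Qed.

Definition Ft_incl : pa_morphism (Ft_pa b) b :=
  @PaMorphism S (Ft_pa b) b id (fun _ _ => erefl) erefl
    (fun s => @pam_M2_intro S (Ft_pa b) b id s (@Ft_incl_M2 s)).

(** In a pair [(x, s)] of the product, [p x = s^+] forces the preimage of [x]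
    under [alpha_s] to lie over [s^*], and such points survive the
    restriction. *)
Lemma U_Ft_incl_bij : bijective (U_mor Ft_incl).
Proof.
have predE (u : pap b) : pap_pred (a := Ft_pa b) (u.1, u.2).
  apply/asboolP; split=> /=; last exact: pap_p.
  exists (pap_inv u); apply/Ft_actP; split; last exact: pap_invP.
  by apply: core_dom; split; [exists u.1; apply: pap_invP | apply: pap_inv_p].
by exists (fun u : pap b => Pap (predE u)) => u; apply: pap_eq.
Qed.

End FtildeInclusion.

(** * A proper cover is the product of its associated action *)

Section GtildeUnit.
Variables (S : restrictionSemigroupType) (psi : proper_morphism S).
Local Notation T := (pm_dom psi).
Implicit Types t u : T.

(** Since [t] itself lies over [psi t], the projection [t^*] is in the core at
    [psi t], and everything below it is acted on through [t]. *)
Lemma Gt_actE t e : (e <= starP t)%O ->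
  Ft_act (Gh_pa psi) (psi t) e = Some (plusP (t * pval e)).
Proof.
move=> et; apply/Ft_actP; split; last first.
  by apply: Gh_funE; split=> //; apply: natle_refl.
exists (starP t); split=> //; split; last exact: Gh_p_star.
by exists (plusP t); apply/Gh_funP; exists t; split=> //; apply: natle_refl.
Qed.

Lemma Gt_act_star t : Ft_act (Gh_pa psi) (psi t) (starP t) = Some (plusP t).
Proof. by rewrite Gt_actE //= mul_rstar. Qed.

Fact Gtilde_unit_subproof t :
  pap_pred (a := Ft_pa (Gh_pa psi)) (plusP t, psi t).
Proof.
apply/asboolP; split=> /=; first by exists (starP t); apply: Gt_act_star.
by apply: proj_inj; rewrite Gh_pE /= rmplus.
Qed.

Definition Gtilde_unit_fun t : pap (Ft_pa (Gh_pa psi)) :=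
  Pap (Gtilde_unit_subproof t).

Lemma Gtilde_unit_inv t : pap_inv (Gtilde_unit_fun t) = starP t.
Proof. by apply: pap_invE => /=; apply: Gt_act_star. Qed.

Fact Gtilde_unit_mul : {morph Gtilde_unit_fun : t u / t * u}.
Proof.
move=> t u; apply: pap_eq; last by rewrite /= rmM.
apply: esym.
apply: (pap_mul_fst_eq (u := Gtilde_unit_fun t) (v := Gtilde_unit_fun u)).
rewrite Gtilde_unit_inv [LHS]Gt_actE ?leIl //; congr Some; apply: proj_inj => /=.
by rewrite mulgA mul_rstar -rplusM.
Qed.

Fact Gtilde_unit_star : {morph Gtilde_unit_fun : t / rstar t}.
Proof.
move=> t; apply: pap_eq; last by rewrite /= rmstar.
by rewrite /= Gtilde_unit_inv plusP_rstar.
Qed.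

Fact Gtilde_unit_plus : {morph Gtilde_unit_fun : t / rplus t}.
Proof.
move=> t; apply: pap_eq; last by rewrite /= rmplus.
by rewrite /= plusP_rplus.
Qed.

HB.instance Definition _ := isMultiplicative.Build
  T (pap (Ft_pa (Gh_pa psi))) Gtilde_unit_fun Gtilde_unit_mul.
HB.instance Definition _ := isRestrictionMorphism.Build
  T (pap (Ft_pa (Gh_pa psi))) Gtilde_unit_fun Gtilde_unit_star Gtilde_unit_plus.

Definition Gtilde_unit : pm_morphism psi (U_obj (Ft_pa (Gh_pa psi))) :=
  @PmMorphism S psi (U_obj (Ft_pa (Gh_pa psi))) Gtilde_unit_fun erefl.

(** For surjectivity, a pair [(e, s)] of the product comes from some [t] with
    [t^+ = e] and [psi t <= s]; as [(psi t)^+ = psi e = s^+], this forces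
    [psi t = s]. *)
Lemma Gtilde_unit_bij : bijective Gtilde_unit.
Proof.
have surj (w : pap (Ft_pa (Gh_pa psi))) : exists t, Gtilde_unit_fun t = w.
  have : Ft_act (Gh_pa psi) w.2 (pap_inv w) = Some w.1 := pap_invP w.
  move=> /Ft_actP[_ /Gh_funP[t [tw _ tE]]].
  exists t; apply: pap_eq => //=.
  have /(congr1 (@pval _)) := pap_p w; rewrite /= -tE /= rmplus => wE.
  by move/natleP: tw => ->; rewrite wE rplus_mul.
have inj : injective Gtilde_unit_fun.
  move=> t u tu; apply: compat_plus.
    by apply: pm_proper; exact: (congr1 (@pap_snd _ _) tu).
  exact: (congr1 (fun w : pap (Ft_pa (Gh_pa psi)) => pval w.1) tu).
exists (fun w => sval (cid (surj w))) => [t|w].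
  exact/inj/(svalP (cid (surj _))).
exact: (svalP (cid (surj w))).
Qed.

End GtildeUnit.

(** * The projections of a product *)

Section ProductProjections.
Variables (S : restrictionSemigroupType) (a : partial_action S).
Local Notation X := (pa_set a).

Fact pap_proj_subproof (x : X) : pap_pred (a := a) (x, pval (pa_p a x)).
Proof.
apply/asboolP; split=> /=; last by rewrite plusP_proj.
by exists x; apply: act_self.
Qed.

Definition pap_proj x : pap a := Pap (pap_proj_subproof x).

Fact Ghat_unit_subproof x : is_proj (pap_proj x).
Proof.
apply/is_proj_rplusP; exists (pap_proj x).
by apply: pap_eq; rewrite //= rplus_proj.
Qed.

Definition Ghat_unit_fun x : proj (pap a) := Proj (Ghat_unit_subproof x).

Definition Gtilde_counit_fun (e : proj (pap a)) : X := (pval e).1.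

(** If [(x, s)] is a projection then [s] is one too, so [s = s^+ = p x]. *)
Lemma Ghat_unit_funK (e : proj (pap a)) :
  Ghat_unit_fun (Gtilde_counit_fun e) = e.
Proof.
apply: proj_inj; apply: pap_eq => //=.
by rewrite pap_p /= -[in RHS](rplus_proj e).
Qed.

Fact Ghat_unit_I x y :
  Ghat_unit_fun (x `&` y)%O = (Ghat_unit_fun x `&` Ghat_unit_fun y)%O.
Proof.
rewrite -[RHS]Ghat_unit_funK; congr Ghat_unit_fun.
by apply: esym; apply: (@pap_mul_proj _ _ (pa_p a x) (pap_proj x)).
Qed.

Fact Gtilde_counit_I (e f : proj (pap a)) :
  Gtilde_counit_fun (e `&` f)%O =
    (Gtilde_counit_fun e `&` Gtilde_counit_fun f)%O.
Proof. by rewrite -(Ghat_unit_funK e) -(Ghat_unit_funK f) -Ghat_unit_I. Qed.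

Fact Ghat_unit_M2 s x y : pa_act a s x = Some y ->
  @Gh_act S (U_obj a) s (Ghat_unit_fun x) = Some (Ghat_unit_fun y).
Proof.
move=> xy; have xpy := act_comp (act_self x) xy.
(* Cutting [s] down to [s p(x)] makes its [^*] equal to [p x]. *)
have uP : pap_pred (a := a) (y, s * pval (pa_p a x)).
  by apply/asboolP; split=> /=; [exists x | apply: p_act].
apply/Gh_funP; exists (Pap uP); split.
- exact: natle_mule.
- by rewrite -[LHS]Ghat_unit_funK; congr Ghat_unit_fun; apply: pap_invE.
- by rewrite -[LHS]Ghat_unit_funK.
Qed.

Fact Ghat_unit_M1 : pa_p a = pa_p (Gh_pa (U_obj a)) \o Ghat_unit_fun.
Proof. by apply/funext => x; apply: proj_inj. Qed.

Definition Ghat_unit : pa_morphism a (Gh_pa (U_obj a)) :=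
  @PaMorphism S a (Gh_pa (U_obj a)) Ghat_unit_fun Ghat_unit_I Ghat_unit_M1
    (fun s => @pam_M2_intro S a (Gh_pa (U_obj a)) Ghat_unit_fun s
      (@Ghat_unit_M2 s)).

(** An element of the product over some [t <= s] with [t^* = s^*] lies over [s]
    itself, so over [s^*] the action of [Ghat (U a)] is that of [a]. *)
Lemma Gh_core_act s (e : proj (pap a)) : core (a := Gh_pa (U_obj a)) s e ->
  pdom (pa_act a s) (pval e).1.
Proof.
move=> [[f /Gh_funP[u [us <- uf]]] ue].
suff us' : u.2 = s by exists u.1; rewrite /= -us'; apply: pap_invP.
have us2 : rstar u.2 = rstar s := congr1 (@pval _) ue.
have -> : u.2 = s * rstar u.2 by apply/natlePr.
by rewrite us2 mul_rstar.
Qed.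

(** This is where [Ftilde] is needed: [e] lies below a point on which [s] acts in
    [a], and the domain of that action is an order ideal.  The value agrees with
    the one in [Ghat (U a)] because [x |-> (x, p x)] is a morphism. *)
Fact Gtilde_counit_M2 s (e f : proj (pap a)) :
  @Ft_act S (Gh_pa (U_obj a)) s e = Some f ->
  pa_act a s (pval e).1 = Some (pval f).1.
Proof.
move=> /Ft_actP[[e0 [/Gh_core_act[y0 xy0] /meet_l le_e]] ef].
have le_x : (Gtilde_counit_fun e <= Gtilde_counit_fun e0)%O.
  have -> : Gtilde_counit_fun e =
      (Gtilde_counit_fun e `&` Gtilde_counit_fun e0)%O.
    by rewrite -Gtilde_counit_I; congr Gtilde_counit_fun.
  exact: leIr.
have [y xy _] := act_down xy0 le_x; rewrite xy; congr Some.
by have := Ghat_unit_M2 xy; rewrite Ghat_unit_funK [LHS]ef => -[->].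
Qed.

Fact Gtilde_counit_M1 :
  pa_p (Ft_pa (Gh_pa (U_obj a))) = pa_p a \o Gtilde_counit_fun.
Proof.
by apply/funext => e; rewrite -{1}(Ghat_unit_funK e); apply: proj_inj.
Qed.

Definition Gtilde_counit : pa_morphism (Ft_pa (Gh_pa (U_obj a))) a :=
  @PaMorphism S (Ft_pa (Gh_pa (U_obj a))) a
    Gtilde_counit_fun Gtilde_counit_I Gtilde_counit_M1
    (fun s => @pam_M2_intro S (Ft_pa (Gh_pa (U_obj a))) a Gtilde_counit_fun s
      (@Gtilde_counit_M2 s)).

Lemma Gtilde_counit_iso : A3b a -> is_iso (C := Defs.catA S) Gtilde_counit.
Proof.
move=> a3b.
have unit_M2 s x y : pa_act a s x = Some y ->
    Ft_act (Gh_pa (U_obj a)) s (Ghat_unit_fun x) = Some (Ghat_unit_fun y).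
  move=> xy; apply/Ft_actP; split; last exact: Ghat_unit_M2.
  have : pdom (pa_act a s) x by exists y.
  rewrite a3b => -[x0 [[[y0 xy0] px0] le_x]]; exists (Ghat_unit_fun x0); split.
    split; first by exists (Ghat_unit_fun y0); apply: Ghat_unit_M2.
    by rewrite -px0; apply: proj_inj.
  by apply/meet_idPl; rewrite -Ghat_unit_I (meet_l le_x).
exists (@PaMorphism S a (Ft_pa (Gh_pa (U_obj a)))
  Ghat_unit_fun Ghat_unit_I Ghat_unit_M1
  (fun s => @pam_M2_intro S a (Ft_pa (Gh_pa (U_obj a))) Ghat_unit_fun s
    (@unit_M2 s))).
by split; apply: pa_morphism_eq => // e; apply: Ghat_unit_funK.
Qed.

End ProductProjections.

(** * The equivalence and the two adjunctions *)

Section Adjunctions.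
Variable S : restrictionSemigroupType.

Lemma Gtilde_unit_natural :
  natural (F := idF (catP S)) (G := compF (Utilde S) (Gtilde S))
    (@Gtilde_unit S).
Proof.
move=> psi chi g; apply: pm_morphism_eq => t; apply: pap_eq => /=.
  by apply: proj_inj; rewrite /= rmplus.
exact: pmmE.
Qed.

Lemma Ghat_unit_natural :
  natural (F := idF (Defs.catA S)) (G := compF (compF (Ihat S) (Ghat S)) (U S))
    (@Ghat_unit S).
Proof.
move=> a b f; apply: pa_morphism_eq => x; apply: proj_inj; apply: pap_eq => //=.
by rewrite pam_p.
Qed.

Lemma Gtilde_counit_natural :
  natural (F := compF (compF (Itilde S) (Gtilde S)) (U S))
    (G := idF (Defs.catA S))
    (@Gtilde_counit S).
Proof. by move=> a b f; apply: pa_morphism_eq. Qed.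

(** The inverse of the counit of the adjunction between [U] and [Ghat]; unlike
    the counit, it has an explicit formula, [t |-> (t^+, psi t)]. *)
Definition Ghat_counit_inv (psi : proper_morphism S) :
    pm_morphism psi (U_obj (Gh_pa psi)) :=
  pm_comp (U_mor (Ft_incl (Gh_pa psi))) (Gtilde_unit psi).

Lemma Ghat_counit_inv_natural :
  natural (F := idF (catP S)) (G := compF (U S) (compF (Ihat S) (Ghat S)))
    Ghat_counit_inv.
Proof.
move=> psi chi g; apply: pm_morphism_eq => t; apply: pap_eq => /=.
  by apply: proj_inj; rewrite /= rmplus.
exact: pmmE.
Qed.

Lemma Ghat_counit_inv_iso (psi : catP S) :
  is_iso (Ghat_counit_inv psi : hom psi _).
Proof.
by apply: (@is_iso_comp (catP S)); apply: pm_bij_iso;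
  [apply: U_Ft_incl_bij | apply: Gtilde_unit_bij].
Qed.

Lemma Utilde_Gtilde_equivalence : establish_equivalence (Utilde S) (Gtilde S).
Proof.
split.
  exists (fun a : catAtilde S => Gtilde_counit (sval a)).
  split=> [a b f|a]; first exact: (Gtilde_counit_natural f).
  exact: Gtilde_counit_iso (svalP a).
apply: nat_iso_inverse Gtilde_unit_natural _ => psi.
exact/pm_bij_iso/Gtilde_unit_bij.
Qed.

(** Cancelling the invertible counit turns the triangle identities into
    [U eta = theta U] and [Ghat theta = eta Ghat], where [eta] is [Ghat_unit]
    and [theta] is [Ghat_counit_inv]. *)
Lemma U_left_adjoint : left_adjoint (U S) (compF (Ihat S) (Ghat S)).
Proof.
have [counit [counitN counitK _]] :=
  natural_inverse Ghat_counit_inv_natural Ghat_counit_inv_iso.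
apply: (unit_counit_adjoint Ghat_unit_natural counitN) => [a|psi].
  rewrite -[RHS](counitK (U S a)); congr compm.
  apply: pm_morphism_eq => u; apply: pap_eq => //=.
  exact: (Ghat_unit_funK (plusP (u : pap a))).
rewrite -[RHS]fmap_id -(counitK psi) [in RHS]fmap_comp; congr compm.
apply: pa_morphism_eq => e; apply: proj_inj; apply: pap_eq => //.
exact: (esym (plusP_proj e)).
Qed.

Lemma U_right_adjoint : left_adjoint (compF (Itilde S) (Gtilde S)) (U S).
Proof.
apply: (@unit_counit_adjoint _ _ (compF (Itilde S) (Gtilde S)) (U S)
  (@Gtilde_unit S) (@Gtilde_counit S)) => [||psi|a].
- exact: Gtilde_unit_natural.
- exact: Gtilde_counit_natural.
- by apply: pa_morphism_eq => e; apply: plusP_proj.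
- by apply: pm_morphism_eq => u; apply: pap_eq.
Qed.

End Adjunctions.

Theorem corollary6p10 (S : restrictionSemigroupType) :
  [/\ establish_equivalence (Utilde S) (Gtilde S),
      left_adjoint (U S) (compF (Ihat S) (Ghat S)) &
      left_adjoint (compF (Itilde S) (Gtilde S)) (U S)].
Proof.
split; first exact: Utilde_Gtilde_equivalence.
  exact: U_left_adjoint.
exact: U_right_adjoint.
Qed.
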